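(* Let $S\ge 2$ and $R\ge 2$ be integers, $N=SR$, and let $n$ be an integer with $0\le n\le N$. Let $X_n$ be the number of pairs in $n$ cards selected uniformly at random from the generalized deck with $S$ suits and $R$ ranks, and let $V[X_n]$ be its variance. If $R\ge 4$, then for $0\le n\le N/2$, $$V[X_n]=\frac{R}{16}+\frac{R(R-1)}{16}\frac{\binom{N-2S}{n}}{\binom{N}{n}}\,{}_2F_1(-n,-2S;N-2S-n+1;-1)-\frac{R^2}{16}\left[\frac{\binom{N-S}{n}}{\binom{N}{n}}\,{}_2F_1(-n,-S;N-S-n+1;-1)\right]^2,$$ and for $N/2\le n\le N$, $$V[X_n]=\frac{R}{16}+\frac{R(R-1)}{16}\frac{\binom{N-2S}{N-n}}{\binom{N}{N-n}}\,{}_2F_1(n-N,-2S;n-2S+1;-1)-\frac{R^2}{16}\left[\frac{\binom{N-S}{N-n}}{\binom{N}{N-n}}\,{}_2F_1(n-N,-S;n-S+1;-1)\right]^2.$$ If $R\le 3$ (i.e. $R=3$ or $R=2$), then for $0\le n\le N/2$, $$V[X_n]=\frac{R}{16}+(-1)^n\frac{R(R-1)}{16}\frac{\binom{2S}{n}}{\binom{N}{n}}\,{}_2F_1(-n,2S-N;2S-n+1;-1)-\frac{R^2}{16}\left[\frac{\binom{N-S}{n}}{\binom{N}{n}}\,{}_2F_1(-n,-S;N-S-n+1;-1)\right]^2,$$ and for $N/2\le n\le N$, $$V[X_n]=\frac{R}{16}+(-1)^{N-n}\frac{R(R-1)}{16}\frac{\binom{2S}{N-n}}{\binom{N}{N-n}}\,{}_2F_1(n-N,2S-N;n+2S-N+1;-1)-\frac{R^2}{16}\left[\frac{\binom{N-S}{N-n}}{\binom{N}{N-n}}\,{}_2F_1(n-N,-S;n-S+1;-1)\right]^2.$$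 In both cases ($R\ge4$ and $R\le 3$), the symmetry $V[X_n]=V[X_{N-n}]$ holds.
   Context: Generalized deck: a set of $N=SR$ distinct cards, one for each (suit, rank) combination, with $S$ suits and $R$ ranks; thus each rank occurs on exactly $S$ cards. A set of $n$ cards is selected uniformly at random among all $n$-element subsets of the deck. A pair is a set of two cards of the same rank. The number of pairs in a set of cards is the maximum number of pairwise disjoint pairs it contains; i.e. if the set contains $y_i$ cards of rank $i$ for $i=1,\dots,R$, the number of pairs is $\sum_{i=1}^R\lfloor y_i/2\rfloor$ (e.g. four cards of one rank count as two pairs, three cards of one rank as one pair). $X_n$ is the number of pairs in the random set of $n$ cards, and $V$ denotes variance. Pochhammer symbol: $(\alpha)_0=1$, $(\alpha)_k=\alpha(\alpha+1)\cdots(\alpha+k-1)$. Gauss hypergeometric function: ${}_2F_1(\alpha,\beta;\gamma;z)=\sum_{k=0}^\infty \frac{(\alpha)_k(\beta)_k}{(\gamma)_k}\frac{z^k}{k!}$ (here the sums are finite since the first two arguments are non-positive integers). $\binom{a}{b}$ for integers $a\ge 0$, $b\ge0$ is the binomial coefficient, equal to $0$ if $b>a$. *)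

(* Defs.v *)
From HB Require Import structures.
From mathcomp Require Import all_boot all_order all_algebra.

Set Implicit Arguments.
Unset Strict Implicit.
Unset Printing Implicit Defensive.

(* A card is a (suit, rank) couple, in a deck with s suits and r ranks. *)
Definition card (s r : nat) : finType := ('I_s * 'I_r)%type.

Section Pairs.
Variables s r : nat.
Implicit Types (A p : {set card s r}) (M : {set {set card s r}}).

Definition is_pair p : bool :=
  (#|p| == 2) && [forall c in p, forall c' in p, c.2 == c'.2].

Definition disjoint_pairs_of A M : bool :=
  trivIset M && [forall p in M, is_pair p && (p \subset A)].

Definition num_pairs A : nat := \max_(M | disjoint_pairs_of A M) #|M|.

End Pairs.

(* Alias carrying the discrete sigma-algebra; the law [deal n] below is
   supported by the hands of size n. *)
Definition hand (s r : nat) : Type := {set card s r}.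

HB.instance Definition _ s r := Finite.copy (hand s r) {set card s r}.

From mathcomp Require Import finmap.
From mathcomp Require Import all_classical all_reals all_analysis.
Import Order.TTheory GRing.Theory Num.Theory.
Import numFieldNormedType.Exports.

Local Open Scope classical_set_scope.
Local Open Scope ring_scope.

HB.instance Definition _ s r :=
  isPointed.Build (hand s r) (finset.set0 : {set card s r}).

HB.instance Definition _ s r := @isMeasurable.Build default_measure_display
  (hand s r) discrete_measurable discrete_measurable0
  discrete_measurableC discrete_measurableU.

Section Deal.
Variables (K : realType) (s r : nat).

Definition hands_of_size (n : nat) : set (hand s r) :=
  [set A : {set card s r} | #|A| = n].

Lemma measurable_hands_of_size n : measurable (hands_of_size n).
Proof. by []. Qed.

Definition count_hands (n : nat) : {measure set (hand s r) -> \bar K} :=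
  mrestr (@counting (hand s r) K) (measurable_hands_of_size n).

(* Uniform distribution on the hands of size n. The Dirac mass is the default
   value required by [mnormalize]; it is only used when there is no hand of
   size n, i.e. when n > s * r (see [deal_set1]). *)
Definition deal (n : nat) : probability (hand s r) K :=
  mnormalize (count_hands n) (dirac (finset.set0 : hand s r)).

Let counting_card (P : pred (hand s r)) :
  counting [set` P] = (#|P|%:R)%:E :> \bar K.
Proof.
have fP : finite_set [set` P] by exact: (@finite_finset (hand s r)).
rewrite /counting asboolT//.
rewrite -card_finset; congr (_%:R%:E); congr (#|` _|).
apply/fsetP => A; rewrite in_fset_set//.
by apply/idP/idP; rewrite ?inE/= ?mem_setE.
Qed.

Lemma deal_set1 n (A : {set card s r}) : (n <= s * r)%N ->
  deal n [set A] = (if #|A| == n then 'C(s * r, n)%:R^-1 else 0)%:E.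
Proof.
move=> n_le.
have cardT : count_hands n setT = 'C(s * r, n)%:R%:E.
  rewrite /count_hands/= /mrestr setTI.
  have -> : hands_of_size n =
      [set` [pred B : hand s r | #|B : {set card s r}| == n]].
    by apply/seteqP; split=> B /eqP.
  rewrite counting_card; congr (_%:R%:E).
  have -> : (s * r)%N = #|card s r| by rewrite card_prod !card_ord.
  by rewrite -card_draws cardsE; apply: eq_card => B; rewrite !inE.
rewrite /deal/= /mnormalize cardT eqe pnatr_eq0 -leqn0 leqNgt bin_gt0 n_le /=.
rewrite /count_hands/= /mrestr; case: eqP => An.
  have -> : [set A : hand s r] `&` hands_of_size n
            = [set` pred1 (A : hand s r)].
    by apply/seteqP; split=> [B [-> _]|B /eqP ->] //=; apply/eqP.
  by rewrite counting_card card1 mul1e.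
have -> : [set A : hand s r] `&` hands_of_size n = set0.
  by apply/seteqP; split=> // B [-> ].
by rewrite measure0 mul0e.
Qed.

(* X_n is the random variable [pair_count] on the probability space [deal n]. *)
Definition pair_count (A : hand s r) : K := (num_pairs A)%:R.

Definition pair_variance (n : nat) : \bar K := ('V_(deal n)[pair_count])%E.

End Deal.

Section Hypergeometric.
Variable K : realType.

Definition pochhammer (a : K) (k : nat) : K := \prod_(i < k) (a + i%:R).

(* The limit of the partial sums. When a or b is a non-positive integer the
   terms vanish from some rank on, provided c is not a non-positive integer
   (as x / 0 = 0, this proviso is needed for the value to be meaningful). *)
Definition gauss2F1 (a b c z : K) : K :=
  limn (series (fun k => pochhammer a k * pochhammer b k / pochhammer c k
                         * (z ^+ k / k`!%:R))).

End Hypergeometric.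

(* Main.v *)
Require Import Defs.
From mathcomp Require Import all_boot all_order all_algebra.
From mathcomp Require Import all_classical all_reals all_analysis.
From mathcomp Require Import zify ring.
Import Order.TTheory GRing.Theory Num.Theory.
Import numFieldNormedType.Exports.
Local Open Scope ring_scope.

(** The floor in the number of pairs is a parity in disguise: a hand with [y]
    cards of some rank has [y./2 = y / 2 - 1 / 4 + (-1) ^ y / 4] pairs there, so
    that on hands of size [n] the number of pairs is a constant plus a quarter
    of [W = \sum_i (-1) ^ y_i] ([num_pairsE], [pair_count_rank_sign_sum]).
    The variance is thus [1 / 16] of the variance of [W]. Expanding [W ^ 2],
    the diagonal terms are [1], and for two distinct ranks
    [(-1) ^ y_i * (-1) ^ y_j] is the sign of the number of cards of the hand
    that lie in the set of [2 s] cards of these ranks. Everything reduces to the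
    sums of [(-1) ^ #|A :&: B|] over the hands [A] of size [n], for a fixed set
    [B] of cards ([signed_count]).

    Such a sum is the coefficient of ['X^n] in
    [(1 - 'X) ^ #|B| * (1 + 'X) ^ (N - #|B|)], because it appears when the
    product over the cards [x] of [1 + 'X] or [1 - 'X], according to whether
    [x] is in [B], is expanded. This coefficient is a value of a Krawtchouk
    polynomial ([signed_countE]), and the terms of its defining sum are, up to a
    common binomial factor, those of a terminating hypergeometric series at
    [-1] ([bin_gauss2F1]). That identification needs [n <= N - #|B|], which
    for the pair term ([#|B| = 2 s]) and [n <= N / 2] holds when [r >= 4] but
    may fail when [r <= 3]; in the latter case the substitution [-'X] for ['X]
    exchanges the roles of [2 s] and [N - 2 s] at the price of the sign
    [(-1) ^ n] ([krawtchoukC]).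

    Finally, replacing hands by their complements multiplies a signed count by
    [(-1) ^ #|B|]. In the variance the signed count for one rank is squared and
    the one for two ranks has [#|B|] even, hence the symmetry
    [n <-> N - n] ([pair_variance_sym]), which also transports the formulas
    from [n <= N / 2] to [n >= N / 2]. *)

(** * Counting disjoint pairs *)

Section NumPairs.
Variables s r : nat.
Implicit Types (A B p : {set Defs.card s r}) (i j : 'I_r).

Definition rank_class i : {set Defs.card s r} := [set c | c.2 == i].

Lemma card_rank_class i : #|rank_class i| = s.
Proof.
have -> : rank_class i = [set (x, i) | x in [set: 'I_s]].
  apply/setP => -[x j]; rewrite inE /=.
  apply/eqP/imsetP => [->|[y _ [_ ->]]] //.
  by exists x; rewrite ?inE.
by rewrite card_imset ?cardsT ?card_ord // => x y [].
Qed.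

Lemma setI_rank_class i j : i != j ->
  rank_class i :&: rank_class j = finset.set0.
Proof.
move=> ij; apply/setP => c; rewrite !inE.
by apply/andP => -[/eqP ci /eqP cj]; rewrite -ci -cj eqxx in ij.
Qed.

Lemma sum_rank_count A : (\sum_i #|A :&: rank_class i|)%N = #|A|.
Proof.
rewrite -sum1_card (partition_big (fun c : Defs.card s r => c.2) predT) //=.
by apply: eq_bigr => i _; rewrite -sum1_card; apply: eq_bigl => c; rewrite !inE.
Qed.

Lemma is_pair_sub p : is_pair p -> exists i, p \subset rank_class i.
Proof.
move=> /andP[/eqP p2 /forall_inP same].
have /card_gt0P[c cp] : (0 < #|p|)%N by rewrite p2.
exists c.2; apply/fintype.subsetP => c' c'p; rewrite inE.
exact: (forall_inP (same c' c'p)).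
Qed.

(** Each pair of the family lies within one rank, and disjoint pairs within a
    rank cover twice as many cards as there are pairs. *)
Lemma disjoint_pairs_leq A M : disjoint_pairs_of A M ->
  (#|M| <= \sum_i #|A :&: rank_class i|./2)%N.
Proof.
move=> /andP[trivM /forall_inP pairM].
pose Mr i := M ::&: (A :&: rank_class i).
have subM : M \subset \bigcup_i Mr i.
  apply/fintype.subsetP => p pM; have /andP[pp pA] := pairM p pM.
  have [i pi] := is_pair_sub p pp.
  by apply/bigcupP; exists i => //; rewrite inE pM finset.subsetI pA pi.
apply: leq_trans (subset_leq_card subM) _.
apply: (@leq_trans (\sum_i #|Mr i|)%N).
  elim/big_ind2: _ => [|x X y Y hx hy|//]; first by rewrite cards0.
  by rewrite cardsU; apply: leq_trans (leq_subr _ _) (leq_add hx hy).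
apply: leq_sum => i _; rewrite geq_half_double -muln2.
have trivMr : finset.trivIset (Mr i).
  by apply: finset.trivIsetS trivM; apply/fintype.subsetP => p;
    rewrite inE => /andP[].
have <- : (\sum_(p in Mr i) #|p| = #|Mr i| * 2)%N.
  rewrite -sum_nat_const; apply: eq_bigr => p; rewrite inE => /andP[pM _].
  by have /andP[/andP[/eqP]] := pairM p pM.
rewrite (eqnP trivMr); apply: subset_leq_card.
by apply/bigcupsP => p; rewrite inE => /andP[].
Qed.

(** Greedy construction: as long as two cards share a rank, set them aside as a
    pair; this lowers the count of that rank by two, hence the sum of the
    halves by one. *)
Lemma disjoint_pairs_ex A : exists2 M, disjoint_pairs_of A M &
  #|M| = (\sum_i #|A :&: rank_class i|./2)%N.
Proof.
have [k] := ubnP #|A|; elim: k A => // k IH A; rewrite ltnS => Ak.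
have [/existsP[i /card_gt1P[x [y [xA yA xy]]]]|noA] :=
    boolP [exists i, (1 < #|A :&: rank_class i|)%N]; last first.
  (* No two cards of A share a rank: all the halves vanish. *)
  exists finset.set0.
    rewrite /disjoint_pairs_of; apply/andP; split.
      by apply/finset.trivIsetP => B C; rewrite inE.
    by apply/forall_inP => p; rewrite inE.
  rewrite cards0 big1 // => i _; apply/eqP; rewrite -leqn0 leq_half_double.
  by rewrite leqNgt; apply: contraNN noA => Ai; apply/existsP; exists i.
move: xA yA; rewrite !inE => /andP[xA /eqP xi] /andP[yA /eqP yi].
pose p : {set Defs.card s r} := [set x; y]%SET.
have p2 : #|p| = 2%N by rewrite cards2 xy.
have pA : p \subset A.
  by apply/fintype.subsetP => z; rewrite !inE => /orP[]/eqP->.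
have pi : p \subset rank_class i.
  by apply/fintype.subsetP => z; rewrite !inE => /orP[]/eqP->; apply/eqP.
have pp : is_pair p.
  rewrite /is_pair p2 eqxx; apply/forall_inP => c /(fintype.subsetP pi).
  rewrite inE => /eqP ->; apply/forall_inP => c' /(fintype.subsetP pi).
  by rewrite inE eq_sym.
have cardD : #|A :\: p| = (#|A| - 2)%N.
  by rewrite cardsD (finset.setIidPr pA) p2.
have A2 : (1 < #|A|)%N by rewrite -p2 subset_leq_card.
have [|M /andP[trivM /forall_inP pairM] cM] := IH (A :\: p).
  rewrite cardD; apply: leq_trans Ak; rewrite ltn_subrL /=.
  exact: ltn_trans A2.
have disp q : q \in M -> [disjoint p & q].
  move=> /pairM /andP[_ /fintype.subsetP qA]; rewrite finset.disjoints_subset.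
  apply/fintype.subsetP => c cp; rewrite inE; apply/negP => /qA.
  by rewrite inE cp.
have M0 : finset.set0 \notin M.
  by apply/negP => /pairM /andP[/andP[]]; rewrite cards0.
have [trivpM pM] := finset.trivIsetU1 disp trivM M0.
exists (p |: M)%SET.
  apply/andP; split=> //.
  apply/forall_inP => q; rewrite inE => /orP[|qM].
    by rewrite inE => /eqP ->; rewrite pp pA.
  have /andP[qq qA] := pairM q qM.
  by rewrite qq (fintype.subset_trans qA) // finset.subsetDl.
rewrite cardsU1 pM cM [RHS](bigD1 i) //= (bigD1 i) //= addnA; congr (_ + _)%N.
  have pAi : p \subset A :&: rank_class i by rewrite finset.subsetI pA.
  rewrite finset.setIDAC cardsD (finset.setIidPr pAi) p2.
  have : (1 < #|A :&: rank_class i|)%N by rewrite -p2 subset_leq_card.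
  by case: #|_| => [|[|m]] //= _; rewrite subn2 /=.
apply: eq_bigr => j ji; congr (#|pred_of_set _|./2); apply/setP => c.
rewrite !finset.in_setI finset.in_setD.
have [cp|//] := boolP (c \in p).
have ci : c.2 = i by apply/eqP; have := fintype.subsetP pi c cp; rewrite inE.
by rewrite inE ci eq_sym (negPf ji) !andbF.
Qed.

Lemma num_pairsE A : num_pairs A = (\sum_i #|A :&: rank_class i|./2)%N.
Proof.
apply/eqP; rewrite eqn_leq; apply/andP; split.
  by apply/bigmax_leqP => M; exact: disjoint_pairs_leq.
have [M dM <-] := disjoint_pairs_ex A.
exact: (@leq_bigmax_cond _ _ (fun M : {set {set Defs.card s r}} => #|M|)).
Qed.

End NumPairs.

(** * Mean and variance on the space of hands *)

(** The space of hands being finite and discrete, the integral splits over the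
    singletons, whose masses are given by [deal_set1]. *)
Lemma expectation_deal (K : realType) (s r n : nat) (f : hand s r -> K) :
  (n <= s * r)%N -> (forall A, 0 <= f A) ->
  'E_(deal K s r n)[f]%E =
  ((\sum_(A : {set Defs.card s r} | #|A| == n) f A) / 'C(s * r, n)%:R)%:E.
Proof.
move=> n_le f0; rewrite unlock.
have setTE : [set: hand s r]%classic =
    \big[setU/set0]_(A <- index_enum (hand s r)) [set A]%classic.
  apply/seteqP; split=> // A _.
  by rewrite -bigcup_seq /=; exists A => //=; exact: mem_index_enum.
rewrite setTE ge0_integral_bigsetU //; last 3 first.
- exact: index_enum_uniq.
- by move=> A B _ _ [C [-> ->]].
- by move=> A _; rewrite lee_fin.
rewrite mulr_suml -sumEFin [RHS]big_mkcond; apply: eq_bigr => A _.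
rewrite (@eq_integral _ _ _ _ _ (cst (f A)%:E)); last first.
  by move=> B; rewrite inE /= => ->.
rewrite integral_cst // [X in (_ * X)%E](deal_set1 K A n_le).
by case: ifP => _; rewrite -EFinM // mulr0.
Qed.

Lemma variance_deal (K : realType) (s r n : nat) (f : hand s r -> K) :
  (n <= s * r)%N -> (forall A, 0 <= f A) ->
  let avg g :=
    (\sum_(A : {set Defs.card s r} | #|A| == n) g A) / 'C(s * r, n)%:R in
  'V_(deal K s r n)[f]%E = (avg (fun A => (f A - avg f) ^+ 2))%:E.
Proof.
move=> n_le f0 avg; rewrite /variance unlock [X in fine X]expectation_deal //.
rewrite expectation_deal // => A; rewrite fctE.
exact: sqr_ge0.
Qed.

(** * Krawtchouk sums and terminating hypergeometric series *)

Section Krawtchouk.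
Variable K : realType.

(** The value at [a] of the [n]-th Krawtchouk polynomial of length [a + b]. *)
Definition krawtchouk (a b n : nat) : K :=
  \sum_(k < n.+1) (-1) ^+ k * 'C(a, k)%:R * 'C(b, n - k)%:R.

(** Reversal of the sum, i.e. the substitution [-'X] for ['X] in
    [(1 - 'X) ^ a * (1 + 'X) ^ b]. *)
Lemma krawtchoukC a b n :
  krawtchouk b a n = (-1) ^+ n * krawtchouk a b n.
Proof.
rewrite /krawtchouk (reindex_inj rev_ord_inj) mulr_sumr /=.
apply: eq_bigr => k _; rewrite subSS subKn; last by rewrite -ltnS.
have kn : (k <= n)%N by rewrite -ltnS.
have -> : (-1) ^+ n = (-1) ^+ (n - k) * (-1) ^+ k :> K by rewrite -exprD subnK.
by rewrite -!mulrA (mulrA ((-1) ^+ k) ((-1) ^+ k)) -expr2 sqrr_sign mul1r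
  [X in _ * X]mulrC.
Qed.

Lemma pochhammer_opp (a k : nat) :
  pochhammer (- a%:R : K) k = (-1) ^+ k * (a ^_ k)%:R.
Proof.
rewrite /pochhammer; elim: k => [|k IH]; first by rewrite big_ord0 mul1r.
rewrite big_ord_recr /= IH ffactnSr exprS natrM.
have [ka|ak] := leqP k a; first by rewrite natrB //; ring.
by rewrite ffact_small // !(mulr0, mul0r).
Qed.

Lemma pochhammer_fact (m k : nat) :
  pochhammer (m%:R + 1 : K) k * m`!%:R = (m + k)`!%:R.
Proof.
rewrite /pochhammer; elim: k => [|k IH]; first by rewrite big_ord0 mul1r addn0.
by rewrite big_ord_recr /= mulrAC IH addnS factS natrM -natr1 natrD; ring.
Qed.

(** The Pochhammer symbol of [- n] vanishes beyond [n], so the partial sums are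
    eventually constant. *)
Lemma gauss2F1_opp (n : nat) (b c z : K) :
  gauss2F1 (- n%:R) b c z =
  \sum_(k < n.+1) pochhammer (- n%:R) k * pochhammer b k / pochhammer c k
                  * (z ^+ k / k`!%:R).
Proof.
rewrite /gauss2F1; apply: (@lim_near_cst _ (@Rhausdorff K)) => //.
exists n.+1 => // m /= nm; rewrite /series /= (big_cat_nat (n := n.+1)) //=.
rewrite [X in _ + X]big_nat_cond [X in _ + X]big1 ?addr0 ?big_mkord // => k.
rewrite andbT => /andP[nk _].
by rewrite pochhammer_opp ffact_small // mulr0 !mul0r.
Qed.

Lemma binR (m n : nat) : (n <= m)%N ->
  'C(m, n)%:R = m`!%:R / (n`!%:R * (m - n)`!%:R) :> K.
Proof.
move=> nm; rewrite -(bin_fact nm) !natrM mulfK // mulf_neq0 //;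
  by rewrite pnatr_eq0 -lt0n fact_gt0.
Qed.

(** Termwise, all factors are quotients of factorials. The condition [n <= b]
    keeps the lower parameter positive, so that no term is spoilt by a division
    by zero. *)
Lemma bin_gauss2F1 (a b n : nat) : (n <= b)%N ->
  'C(b, n)%:R * gauss2F1 (- n%:R) (- a%:R) (b%:R - n%:R + 1) (-1) =
  krawtchouk a b n.
Proof.
move=> nb; rewrite gauss2F1_opp mulr_sumr; apply: eq_bigr => k _.
have kn : (k <= n)%N by rewrite -ltnS.
have f0 m : m`!%:R != 0 :> K by rewrite pnatr_eq0 -lt0n fact_gt0.
have nbk : (n - k <= b)%N := leq_trans (leq_subr _ _) nb.
have E1 : (a ^_ k)%:R = 'C(a, k)%:R * k`!%:R :> K by rewrite -natrM bin_ffact.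
have E2 : (n ^_ k)%:R = n`!%:R / (n - k)`!%:R :> K.
  by rewrite -(ffact_fact kn) natrM mulfK.
have E3 : pochhammer (b%:R - n%:R + 1 : K) k = (b - n + k)`!%:R / (b - n)`!%:R.
  by rewrite -natrB // -pochhammer_fact mulfK.
rewrite !pochhammer_opp E1 E2 E3 (binR _ _ nb) (binR _ _ nbk).
have -> : (b - (n - k) = b - n + k)%N by rewrite subnA // addnBAC.
have s1 : (-1) ^+ k * (-1) ^+ k = 1 :> K by rewrite -expr2 sqrr_sign.
transitivity ((-1) ^+ k * ((-1) ^+ k * (-1) ^+ k) * 'C(a, k)%:R *
   (b`!%:R / ((n - k)`!%:R * (b - n + k)`!%:R)) : K).
  by field; rewrite !f0.
by rewrite s1 mulr1.
Qed.

End Krawtchouk.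

(** * Parity of the intersection with a fixed set *)

Section SignedCount.
Variables (K : realType) (T : finType).
Implicit Types A B : {set T}.

(** Up to the factor ['C(#|T|, n)], the mean of the parity sign of
    [#|A :&: B|] for a uniform [A] of size [n]. *)
Definition signed_count B n : K :=
  \sum_(A : {set T} | #|A| == n) (-1) ^+ #|A :&: B|.

Lemma sign_card_setI A B :
  (-1) ^+ #|A :&: B| = \prod_(x in A) (-1) ^+ (x \in B) :> K.
Proof.
rewrite prodrXr; congr (_ ^+ _); rewrite -sum1_card.
rewrite (eq_bigl (fun x => (x \in A) && (x \in B))); last first.
  by move=> x; rewrite inE.
by rewrite big_mkcondr; apply: eq_bigr => x _; case: (x \in B).
Qed.

(** Expansion of the product of the linear factors [1 + e_x 'X], where [e_x] is
    [-1] on [B] and [1] elsewhere: a set [A] contributes the sign of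
    [#|A :&: B|] times ['X^#|A|]. *)
Lemma signed_count_coef B n :
  signed_count B n = ((1 - 'X) ^+ #|B| * (1 + 'X) ^+ #|~: B| : {poly K})`_n.
Proof.
have -> : (1 - 'X) ^+ #|B| * (1 + 'X) ^+ #|~: B| =
          \prod_x (((-1) ^+ (x \in B))%:P * 'X + 1) :> {poly K}.
  rewrite (bigID (mem B)) /= -!prodr_const; congr (_ * _).
    by apply: eq_bigr => x ->; rewrite expr1 rmorphN1 mulN1r addrC.
  apply: eq_big => [x|x]; first by rewrite inE.
  by rewrite inE => /negPf ->; rewrite expr0 mul1r addrC.
rewrite bigA_distr coef_sum /signed_count [LHS]big_mkcond /=.
apply: eq_bigr => A _; rewrite -big_mkcond /= big_split /= prodr_const.
rewrite -rmorph_prod /= -sign_card_setI coefCM coefXn eq_sym.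
by case: eqP => _; rewrite ?mulr1 ?mulr0.
Qed.

Lemma coef_1addX_exp (c : K) (m k : nat) :
  ((1 + c *: 'X) ^+ m : {poly K})`_k = c ^+ k * 'C(m, k)%:R.
Proof.
rewrite exprDn coef_sum.
under eq_bigr => i _ do
  rewrite expr1n mul1r exprZn coefMn coefZ coefXn
    -[_ *+ 'C(_, _)]mulr_natr -mulrA.
have [km|mk] := leqP k m.
  rewrite (bigD1 (Ordinal (km : k < m.+1)%N)) //= eqxx mul1r big1 ?addr0 //.
  move=> i; rewrite -val_eqE /= eq_sym => /negPf ->.
  by rewrite mul0r mulr0.
rewrite bin_small // mulr0 big1 // => i _.
by rewrite gtn_eqF ?mul0r ?mulr0 // (leq_ltn_trans _ mk) // -ltnS.
Qed.

Lemma signed_countE B n :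
  signed_count B n = krawtchouk K #|B| (#|T| - #|B|) n.
Proof.
rewrite signed_count_coef coefM.
have -> : (#|T| - #|B| = #|~: B|)%N by rewrite -(cardsC B) addKn.
apply: eq_bigr => k _.
by rewrite -scaleN1r coef_1addX_exp -[X in 1 + X]scale1r coef_1addX_exp
  expr1n mul1r.
Qed.

Lemma signed_count_set0 n : signed_count finset.set0 n = 'C(#|T|, n)%:R.
Proof.
rewrite /signed_count; under eq_bigr do rewrite finset.setI0 cards0 expr0.
by rewrite sumr_const -cardsE card_draws.
Qed.

(** Complementation turns [#|A :&: B|] into [#|B| - #|A :&: B|]. *)
Lemma signed_count_compl B n : (n <= #|T|)%N ->
  signed_count B (#|T| - n)%N = (-1) ^+ #|B| * signed_count B n.
Proof.
move=> nT; rewrite /signed_count mulr_sumr.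
rewrite (reindex_inj (@finset.setC_inj T)) /=.
apply: eq_big => A.
  have := cardsC A; have := max_card (mem A) => leA sumA.
  by rewrite -(eqn_add2l #|A|) sumA -{1}(subnK nT) addnC eqn_add2r eq_sym.
move=> _; rewrite -[in RHS](cardsID A B) [A :&: B]finset.setIC.
rewrite exprD mulrAC -exprD addnn.
by rewrite -muln2 exprM sqrr_sign mul1r finset.setDE finset.setIC.
Qed.

End SignedCount.

(** * The variance in terms of Krawtchouk sums *)

Section Variance.
Variable K : realType.

(** The variance of an affine function [a + b w] is [b ^ 2] times that of [w],
    the latter in the form of the mean square minus the squared mean. *)
Lemma avg_sqr_dev_affine (I : finType) (P : pred I) (C a b : K) (f w : I -> K) :
  C != 0 -> \sum_(x | P x) 1 = C -> (forall x, P x -> f x = a + b * w x) ->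
  (\sum_(x | P x) (f x - (\sum_(x | P x) f x) / C) ^+ 2) / C =
  b ^+ 2 * ((\sum_(x | P x) w x ^+ 2) / C - ((\sum_(x | P x) w x) / C) ^+ 2).
Proof.
move=> C0 sum1 fE.
set m := (\sum_(x | P x) w x) / C.
have sumw : \sum_(x | P x) w x = C * m by rewrite mulrC divfK.
have -> : \sum_(x | P x) f x = C * (a + b * m).
  rewrite (eq_bigr _ fE) big_split /= -mulr_sumr sumw -[a]mulr1 -mulr_sumr sum1.
  by ring.
rewrite [C * _]mulrC mulfK //.
rewrite (eq_bigr (fun x => b ^+ 2 * (w x ^+ 2 + - (2 * m) * w x + m ^+ 2 * 1))).
  rewrite -mulr_sumr !big_split /= -!mulr_sumr sumw sum1.
  by field.
by move=> x /fE ->; ring.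
Qed.

Lemma half_sign (m : nat) : (m./2)%:R = m%:R / 2 - 4^-1 + (-1) ^+ m / 4 :> K.
Proof.
rewrite -{2}(odd_double_half m) -[(-1) ^+ m]signr_odd -mul2n natrD natrM.
by case: (odd m); rewrite /= ?expr1 ?expr0; field.
Qed.

Section Ranks.
Variables s r : nat.
Local Notation N := (s * r)%N.
Implicit Type A : {set Defs.card s r}.

Let card_deck : #|Defs.card s r| = N.
Proof. by rewrite card_prod !card_ord. Qed.

Definition rank_sign_sum A : K :=
  \sum_(i < r) (-1) ^+ #|A :&: rank_class s r i|.

Lemma pair_count_rank_sign_sum n A : #|A| == n ->
  pair_count K A = n%:R / 2 - r%:R / 4 + 4^-1 * rank_sign_sum A.
Proof.
move=> /eqP <-; rewrite /pair_count num_pairsE natr_sum.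
rewrite (eq_bigr _ (fun i _ => half_sign _)) !big_split /= -!mulr_suml.
rewrite -natr_sum sum_rank_count sumr_const card_ord -[(- _) *+ _]mulr_natr.
by rewrite /rank_sign_sum; ring.
Qed.

Lemma sum_rank_sign_sum n :
  \sum_(A : {set Defs.card s r} | #|A| == n) rank_sign_sum A =
  r%:R * krawtchouk K s (N - s) n.
Proof.
rewrite exchange_big /= (eq_bigr (fun=> krawtchouk K s (N - s) n)).
  by rewrite sumr_const card_ord mulr_natl.
move=> i _.
rewrite -/(signed_count K _ (rank_class s r i) n) signed_countE.
by rewrite card_rank_class card_deck.
Qed.

(** In the expansion of the square, the diagonal terms are [1], and two distinct
    ranks contribute the sign of their union. *)
Lemma sum_rank_sign_sum_sqr n :
  \sum_(A : {set Defs.card s r} | #|A| == n) rank_sign_sum A ^+ 2 =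
  r%:R * 'C(N, n)%:R
  + r%:R * (r%:R - 1) * krawtchouk K (2 * s) (N - 2 * s) n.
Proof.
(* On the diagonal the two signs cancel: this is the signed count of the
   empty set. *)
pose B i j : {set Defs.card s r} := if i == j then finset.set0
  else rank_class s r i :|: rank_class s r j.
have signM A i j : (-1) ^+ #|A :&: rank_class s r i|
    * (-1) ^+ #|A :&: rank_class s r j| = (-1) ^+ #|A :&: B i j| :> K.
  rewrite /B; case: eqVneq => [->|ij].
    by rewrite -expr2 sqrr_sign finset.setI0 cards0.
  rewrite -exprD finset.setIUr cardsU.
  by rewrite -finset.setIIr setI_rank_class // finset.setI0 cards0 subn0.
have cB i j : i != j -> #|B i j| = (2 * s)%N.
  move=> ij; rewrite /B (negPf ij) cardsU !card_rank_class.
  by rewrite setI_rank_class // cards0 subn0 addnn mul2n.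
transitivity (\sum_(i < r) \sum_(j < r) signed_count K _ (B i j) n).
  rewrite /signed_count; under [RHS]eq_bigr => i _ do rewrite exchange_big /=.
  rewrite exchange_big /=; apply: eq_bigr => A _.
  rewrite expr2 big_distrlr /=; apply: eq_bigr => i _.
  by apply: eq_bigr => j _; rewrite signM.
set G := krawtchouk _ _ _ _.
rewrite (eq_bigr (fun=> 'C(N, n)%:R + (r%:R - 1) * G)).
  by rewrite sumr_const card_ord -mulr_natl; ring.
move=> i _; rewrite (bigD1 i) //= {1}/B eqxx signed_count_set0 card_deck.
congr (_ + _); rewrite (eq_bigr (fun=> G)).
  have r0 : (0 < r)%N by exact: leq_ltn_trans (ltn_ord i).
  by rewrite sumr_const cardC1 card_ord -[G *+ _]mulr_natl -subn1 natrB.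
by move=> j ji; rewrite signed_countE cB ?card_deck // eq_sym.
Qed.

Lemma pair_varianceE n : (n <= N)%N ->
  pair_variance K s r n =
  (r%:R / 16
   + r%:R * (r%:R - 1) / 16 * (krawtchouk K (2 * s) (N - 2 * s) n / 'C(N, n)%:R)
   - r%:R ^+ 2 / 16 * (krawtchouk K s (N - s) n / 'C(N, n)%:R) ^+ 2)%:E.
Proof.
move=> nN; have C0 : 'C(N, n)%:R != 0 :> K.
  by rewrite pnatr_eq0 -lt0n bin_gt0.
rewrite /pair_variance variance_deal //.
congr (_%:E).
rewrite (avg_sqr_dev_affine _ _ 'C(N, n)%:R _ _ _ _ C0 _
  (fun A => pair_count_rank_sign_sum n A)).
  rewrite sum_rank_sign_sum sum_rank_sign_sum_sqr; field.
  by rewrite C0.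
by rewrite sumr_const -cardsE card_draws card_deck.
Qed.

(** The symmetry of signed counts under complementation, read off on a set of
    cards of the prescribed size. *)
Lemma krawtchouk_rev a n : (n <= N)%N -> (a <= N)%N ->
  krawtchouk K a (N - a) (N - n) = (-1) ^+ a * krawtchouk K a (N - a) n.
Proof.
move=> nN aN.
have [B Ba] : exists B : {set Defs.card s r}, #|B| = a.
  have [B] : exists B, B \in [set B : {set Defs.card s r} | #|B| == a].
    by apply/card_gt0P; rewrite card_draws card_deck bin_gt0.
  by rewrite inE => /eqP; exists B.
have := signed_count_compl K _ B n.
by rewrite card_deck !signed_countE Ba card_deck; apply.
Qed.

Lemma pair_variance_sym n : (2 <= r)%N -> (n <= N)%N ->
  pair_variance K s r n = pair_variance K s r (N - n).
Proof.
move=> r2 nN.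
have s2 : (2 * s <= N)%N by rewrite mulnC leq_mul2l r2 orbT.
have s1 : (s <= N)%N by rewrite leq_pmulr // ltnW.
rewrite !pair_varianceE ?leq_subr // bin_sub // !krawtchouk_rev //.
rewrite exprM sqrrN !expr1n mul1r -[(-1) ^+ s * _ / _]mulrA [in RHS]exprMn.
by rewrite sqrr_sign mul1r.
Qed.

End Ranks.

(** * Hypergeometric form *)

Lemma bin_gauss2F1_frac (N a b n : nat) : (n <= b)%N ->
  'C(b, n)%:R / 'C(N, n)%:R
    * gauss2F1 (- n%:R) (- a%:R) (b%:R - n%:R + 1) (- 1)
  = krawtchouk K a b n / 'C(N, n)%:R.
Proof. by move=> nb; rewrite mulrAC bin_gauss2F1. Qed.

Section Formulas.
Variables (s r : nat).
Hypothesis r_ge2 : (2 <= r)%N.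
Local Notation N := (s * r)%N.
Local Notation mean_term m :=
  ('C(N - s, m)%:R / 'C(N, m)%:R
   * gauss2F1 (- m%:R) (- s%:R) (N%:R - s%:R - m%:R + 1) (- 1) : K).

Let s_leN : (s <= N)%N. Proof. by rewrite leq_pmulr // ltnW. Qed.
Let ss_leN : (2 * s <= N)%N. Proof. by rewrite mulnC leq_mul2l r_ge2 orbT. Qed.

Let mean_termE m : (2 * m <= N)%N ->
  mean_term m = krawtchouk K s (N - s) m / 'C(N, m)%:R.
Proof.
move=> mN; rewrite -bin_gauss2F1_frac ?natrB //.
rewrite -(leq_pmul2l (isT : 0 < 2)%N) mulnBr.
by apply: leq_trans mN _; rewrite leq_subRL; lia.
Qed.

Lemma pair_variance_ge4 m : (4 <= r)%N -> (2 * m <= N)%N ->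
  pair_variance K s r m = (r%:R / 16%:R
          + r%:R * (r%:R - 1) / 16%:R
            * ('C(N - 2 * s, m)%:R / 'C(N, m)%:R)
            * gauss2F1 (- m%:R) (- (2 * s)%:R)
                       (N%:R - (2 * s)%:R - m%:R + 1) (- 1)
          - r%:R ^+ 2 / 16%:R * (mean_term m) ^+ 2)%:E.
Proof.
move=> r4 mN; rewrite mean_termE // pair_varianceE; last by lia.
rewrite -[_ * (_ / _) * gauss2F1 _ _ _ _]mulrA -natrB // bin_gauss2F1_frac //.
by nia.
Qed.

Lemma pair_variance_le3 m : (r <= 3)%N -> (2 * m <= N)%N ->
  pair_variance K s r m = (r%:R / 16%:R
          + (- 1) ^+ m * (r%:R * (r%:R - 1) / 16%:R)
            * ('C(2 * s, m)%:R / 'C(N, m)%:R)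
            * gauss2F1 (- m%:R) ((2 * s)%:R - N%:R)
                       ((2 * s)%:R - m%:R + 1) (- 1)
          - r%:R ^+ 2 / 16%:R * (mean_term m) ^+ 2)%:E.
Proof.
move=> r3 mN; rewrite mean_termE // pair_varianceE; last by lia.
rewrite -[_ * (_ / _) * gauss2F1 _ _ _ _]mulrA -[(2 * s)%:R - N%:R]opprB.
rewrite -[N%:R - _]natrB //.
have m2s : (m <= 2 * s)%N by nia.
rewrite (bin_gauss2F1_frac _ _ _ _ m2s).
rewrite krawtchoukC.
by congr (_ + _ - _)%:E; ring.
Qed.

End Formulas.

End Variance.

Theorem theorem2p2 (K : realType) (s r n : nat)
    (hs : (2 <= s)%N) (hr : (2 <= r)%N) (hn : (n <= s * r)%N) :
  let N := (s * r)%N in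
  let V := pair_variance K s r in
  [/\ (4 <= r)%N ->
      ((2 * n <= N)%N ->
        V n = (r%:R / 16%:R
          + r%:R * (r%:R - 1) / 16%:R
            * ('C(N - 2 * s, n)%:R / 'C(N, n)%:R)
            * gauss2F1 (- n%:R) (- (2 * s)%:R)
                       (N%:R - (2 * s)%:R - n%:R + 1) (- 1)
          - r%:R ^+ 2 / 16%:R
            * ('C(N - s, n)%:R / 'C(N, n)%:R
               * gauss2F1 (- n%:R) (- s%:R)
                          (N%:R - s%:R - n%:R + 1) (- 1)) ^+ 2)%:E)
      /\
      ((N <= 2 * n)%N ->
        V n = (r%:R / 16%:R
          + r%:R * (r%:R - 1) / 16%:R
            * ('C(N - 2 * s, N - n)%:R / 'C(N, N - n)%:R)
            * gauss2F1 (n%:R - N%:R) (- (2 * s)%:R)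
                       (n%:R - (2 * s)%:R + 1) (- 1)
          - r%:R ^+ 2 / 16%:R
            * ('C(N - s, N - n)%:R / 'C(N, N - n)%:R
               * gauss2F1 (n%:R - N%:R) (- s%:R)
                          (n%:R - s%:R + 1) (- 1)) ^+ 2)%:E),
      (r <= 3)%N ->
      ((2 * n <= N)%N ->
        V n = (r%:R / 16%:R
          + (- 1) ^+ n * (r%:R * (r%:R - 1) / 16%:R)
            * ('C(2 * s, n)%:R / 'C(N, n)%:R)
            * gauss2F1 (- n%:R) ((2 * s)%:R - N%:R)
                       ((2 * s)%:R - n%:R + 1) (- 1)
          - r%:R ^+ 2 / 16%:R
            * ('C(N - s, n)%:R / 'C(N, n)%:R
               * gauss2F1 (- n%:R) (- s%:R)
                          (N%:R - s%:R - n%:R + 1) (- 1)) ^+ 2)%:E)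
      /\
      ((N <= 2 * n)%N ->
        V n = (r%:R / 16%:R
          + (- 1) ^+ (N - n) * (r%:R * (r%:R - 1) / 16%:R)
            * ('C(2 * s, N - n)%:R / 'C(N, N - n)%:R)
            * gauss2F1 (n%:R - N%:R) ((2 * s)%:R - N%:R)
                       (n%:R + (2 * s)%:R - N%:R + 1) (- 1)
          - r%:R ^+ 2 / 16%:R
            * ('C(N - s, N - n)%:R / 'C(N, N - n)%:R
               * gauss2F1 (n%:R - N%:R) (- s%:R)
                          (n%:R - s%:R + 1) (- 1)) ^+ 2)%:E)
    & V n = V (N - n)%N].
Proof.
move=> N V.
have symV : V n = V (N - n)%N by exact: pair_variance_sym.
(* The hypergeometric parameters for n >= N / 2 are those of the first case at
   N - n. *)
have castN : n%:R - N%:R = - (N - n)%:R :> K by rewrite natrB // opprB.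
have cast1 c : n%:R - c + 1 = N%:R - c - (N - n)%:R + 1 :> K.
  by rewrite natrB //; ring.
have cast2 : n%:R + (2 * s)%:R - N%:R + 1 = (2 * s)%:R - (N - n)%:R + 1 :> K.
  by rewrite natrB //; ring.
have half : (N <= 2 * n)%N -> (2 * (N - n) <= N)%N by lia.
split=> [r4|r3|//]; split=> [nN|/half nN].
- exact: pair_variance_ge4.
- by rewrite symV castN !cast1; exact: pair_variance_ge4.
- exact: pair_variance_le3.
- by rewrite symV castN cast1 cast2; exact: pair_variance_le3.
Qed.
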